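(* Let $r$ be an odd prime power, $q=r^2$, let $e,f$ be positive integers with $q-1=ef$, and let $R=\frac{r+1}{\gcd(r+1,f)}$. Let $t$ be an integer with $1\le t\le R$ such that $tf$ is even. If $e$ is even, then there exists a $q$-ary NMDS self-dual code of length $tf$.
   Context: A $q$-ary $[n,k,d]$-linear code is a subspace $\mathcal C$ of $\mathbb F_q^n$ (with $\mathbb F_q$ the finite field of $q$ elements) of dimension $k$ and minimum (Hamming) distance $d$; $n$ is its length. Its dual is $\mathcal C^{\bot}=\{b\in\mathbb F_q^n : \sum_{i=1}^n a_ib_i=0 \text{ for all } a\in\mathcal C\}$; $\mathcal C$ is self-dual if $\mathcal C=\mathcal C^{\bot}$. An $[n,k,d]$-linear code is AMDS if $d=n-k$. An AMDS code $\mathcal C$ is NMDS if $\mathcal C^{\bot}$ is also AMDS.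
   Formalization: The length tf = 2 is excluded: a self-dual code of length 2 has dimension 1, so AMDS would force a codeword of weight 1, which is never self-orthogonal; hence no NMDS self-dual code of length 2 exists and the claim fails there (e.g. r = 3, f = 1, t = 2). *)

(* Defs.v *)
From HB Require Import structures.
From mathcomp Require Import all_boot all_order all_algebra all_field.

Set Implicit Arguments.
Unset Strict Implicit.
Unset Printing Implicit Defensive.

Import GRing.Theory.

Definition prime_power (r : nat) : Prop :=
  exists p m : nat, [/\ prime p, 0 < m & r = p ^ m].

Section Codes.

Variables (F : finFieldType) (n : nat).
Implicit Types (C : {vspace 'rV[F]_n}) (x y a b : 'rV[F]_n).

Local Open Scope ring_scope.

Definition hamming_dist x y : nat := #|[set i | x ord0 i != y ord0 i]|.

(* A relation rather than a function: the zero code has no minimum distance. *)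
Definition is_min_dist C (d : nat) : Prop :=
  (exists x y, [/\ x \in C, y \in C, x != y & hamming_dist x y = d]) /\
  (forall x y, x \in C -> y \in C -> x != y -> (d <= hamming_dist x y)%N).

Definition is_linear_code C (k d : nat) : Prop :=
  \dim C = k /\ is_min_dist C d.

Definition dotp a b : F := \sum_(i < n) a ord0 i * b ord0 i.

Definition orthogonal_to C b : bool := [forall a in C, dotp a b == 0].

(* The span only packages the orthogonal vectors as a {vspace _}; they already
   form a subspace, see [dual_codeP]. *)
Definition dual_code C : {vspace 'rV[F]_n} :=
  <<enum (orthogonal_to C)>>%VS.

Lemma dual_codeP C b :
  reflect (forall a, a \in C -> \sum_(i < n) a ord0 i * b ord0 i = 0)
          (b \in dual_code C).
Proof.
have memE : (b \in dual_code C) = orthogonal_to C b.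
  apply/idP/idP => [bC | ob]; last by apply: memv_span; rewrite mem_enum.
  apply/forall_inP => a aC; apply/eqP.
  rewrite (coord_span (X := in_tuple _) bC) /dotp.
  under eq_bigr => i _ do rewrite summxE mulr_sumr.
  rewrite exchange_big big1 // => j _ /=.
  under eq_bigr => i _ do rewrite mxE mulrCA.
  rewrite -mulr_sumr.
  have : (enum (orthogonal_to C))`_j \in enum (orthogonal_to C).
    by rewrite mem_nth.
  rewrite mem_enum => /forall_inP /(_ a aC) /eqP.
  by rewrite /dotp => ->; rewrite mulr0.
rewrite memE; apply: (iffP forall_inP) => H a aC; first exact/eqP/H.
exact/eqP/H.
Qed.

Definition self_dual C : Prop := C = dual_code C.

Definition AMDS C : Prop :=
  exists k d : nat, is_linear_code C k d /\ d = (n - k)%N.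

Definition NMDS C : Prop := AMDS C /\ AMDS (dual_code C).

End Codes.

(* Main.v *)
(* Take S in F with |S| = n = 2k, and let w x be the product of x - y over the
   other y in S.  Lagrange interpolation gives \sum_(x in S) x ^ j / w x = 0 for
   j <= n - 2, and also for j = n if S sums to zero.  Hence, if v x ^ 2 / w x is
   a nonzero constant on S, evaluating the span of 1, X, ..., X^(k-2), X^k on S
   with multipliers v x / w x yields a self-dual code.  A nonzero polynomial of
   degree at most k has at most k roots, so the minimum distance is at least k;
   it is k as soon as some k-subset T of S sums to zero, because set_poly T
   then has no X^(k-1) term.

   Up to a constant factor, the multipliers exist iff the w x all have the same
   quadratic character.  For f > 2, S is a union of t cosets of the group of
   f-th roots of unity, represented by elements of order dividing r + 1, and T
   consists of half of the cosets (f odd) or of half of each coset (f even),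
   so that it is invariant under a nontrivial root of unity.  For f <= 2
   the length is at most r + 1: length r + 1 falls under the previous case with
   (f, t) replaced by (r + 1, 1), and for smaller lengths S can be taken inside
   the subfield of order r, all of whose elements are squares.  There S is a
   union of two zero-sum k-sets, each made of pairs {x, -x} and, if k is odd,
   of a triple {1, b, -1 - b} or its opposite. *)

Require Import Defs.
From mathcomp Require Import all_boot all_order all_algebra all_field.
From mathcomp Require Import all_solvable.
From mathcomp Require Import zify ring.

Set Implicit Arguments.
Unset Strict Implicit.
Unset Printing Implicit Defensive.

Import GRing.Theory.
Local Open Scope ring_scope.

(** * Lagrange interpolation at the elements of a finite set *)

Section Interpolation.

Variable F : finFieldType.
Implicit Types (S T : {set F}) (p : {poly F}).

Definition node_weight S x : F := \prod_(y in S :\ x) (x - y).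

Lemma node_weight_neq0 S x : node_weight S x != 0.
Proof.
by apply/prodf_neq0 => y; rewrite !inE subr_eq0 eq_sym => /andP[].
Qed.

Definition set_poly S : {poly F} := \prod_(y in S) ('X - y%:P).

Lemma set_polyE S : set_poly S = \prod_(y <- enum S) ('X - y%:P).
Proof. by rewrite big_enum. Qed.

Lemma size_set_poly S : size (set_poly S) = #|S|.+1.
Proof. by rewrite set_polyE size_prod_XsubC -cardE. Qed.

Lemma monic_set_poly S : set_poly S \is monic.
Proof. by rewrite set_polyE monic_prod_XsubC. Qed.

Lemma root_set_poly S x : root (set_poly S) x = (x \in S).
Proof. by rewrite set_polyE root_prod_XsubC mem_enum. Qed.

Lemma lead_coef_set_poly S : (set_poly S)`_#|S| = 1.
Proof. by have /monicP := monic_set_poly S; rewrite /lead_coef size_set_poly. Qed.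

Lemma subleading_coef_set_poly S :
  (0 < #|S|)%N -> (set_poly S)`_#|S|.-1 = - \sum_(x in S) x.
Proof.
move=> S_gt0; rewrite set_polyE -big_enum cardE coefPn_prod_XsubC //.
by rewrite -cardE -lt0n.
Qed.

Lemma set_roots_eq0 S p :
  {in S, forall x, root p x} -> (size p <= #|S|)%N -> p = 0.
Proof.
move=> rp sp; apply/eqP/negP => /negP p0.
suff : (size (enum S) < size p)%N by rewrite -cardE ltnNge sp.
apply: max_poly_roots => //; last exact: enum_uniq.
by apply/allP => x; rewrite mem_enum => /rp.
Qed.

(** The leading terms cancel in the difference, which then has degree below #|S| and vanishes on
    S. *)
Lemma monic_set_polyE S p :
  p \is monic -> size p = #|S|.+1 -> {in S, forall x, root p x} ->
  p = set_poly S.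
Proof.
move=> mp sp rp; apply/eqP; rewrite -subr_eq0; apply/eqP.
apply: (@set_roots_eq0 S) => [x xS|].
  by rewrite rootE !hornerE (rootP (rp x xS)) (rootP _) ?root_set_poly ?subr0.
apply/leq_sizeP => j Sj; rewrite coefB; have [Sj' | jS] := ltnP #|S| j.
  by rewrite !nth_default ?subr0 ?size_set_poly ?sp.
have -> : j = #|S| by apply/eqP; rewrite eqn_leq Sj jS.
rewrite lead_coef_set_poly; move/monicP: mp; rewrite /lead_coef sp /= => ->.
by rewrite subrr.
Qed.

Lemma deriv_set_poly S x : x \in S -> (set_poly S)^`().[x] = node_weight S x.
Proof.
move=> xS; rewrite /set_poly (big_setD1 x) //= derivM derivXsubC mul1r.
rewrite hornerD hornerM !hornerXsubC subrr mul0r addr0 horner_prod.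
by apply: eq_bigr => y _; rewrite hornerXsubC.
Qed.

(** Compares the coefficients of degree #|S| - 1 in the interpolation formula for p. *)
Lemma lagrange_leading_coef S p : (size p <= #|S|)%N ->
  \sum_(x in S) p.[x] / node_weight S x = p`_#|S|.-1.
Proof.
move=> sp; pose L x := p.[x] / node_weight S x *: set_poly (S :\ x).
have sL x : x \in S -> (size (L x) <= #|S|)%N.
  move=> xS; apply: leq_trans (size_scale_leq _ _) _.
  by rewrite size_set_poly (cardsD1 x S) xS.
have pE : p = \sum_(x in S) L x.
  apply/eqP; rewrite -subr_eq0; apply/eqP; apply: (@set_roots_eq0 S).
    move=> z zS; rewrite rootE hornerD hornerN horner_sum (big_setD1 z) //=.
    rewrite big1 => [|x /setD1P[xz xS]]; last first.
      have /rootP xz0 : root (set_poly (S :\ x)) z.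
        by rewrite root_set_poly !inE eq_sym xz.
      by rewrite hornerZ xz0 mulr0.
    rewrite hornerZ addr0 horner_prod.
    under [X in _ / _ * X]eq_bigr => y _ do rewrite hornerXsubC.
    by rewrite -/(node_weight S z) divfK ?node_weight_neq0 // subrr.
  apply: leq_trans (size_polyD _ _) _; rewrite size_polyN geq_max sp.
  by apply: leq_trans (size_sum _ _ _) _; apply/bigmax_leqP.
rewrite [in RHS]pE coef_sum; apply: eq_bigr => x xS.
rewrite coefZ (_ : #|S|.-1 = #|S :\ x|) ?lead_coef_set_poly ?mulr1 //.
by rewrite (cardsD1 x S) xS.
Qed.

Lemma sum_expr_node_weight S j : \sum_(x in S) x = 0 ->
  (j <= #|S|)%N -> j != #|S|.-1 ->
  \sum_(x in S) x ^+ j / node_weight S x = 0.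
Proof.
move=> S0 jS jS1; case: (posnP #|S|) => [/eqP|S_gt0].
  by rewrite cards_eq0 => /eqP->; rewrite big_set0.
have [jltS | Sj] := ltnP j #|S|.
  under eq_bigr => x _ do rewrite -hornerXn.
  by rewrite lagrange_leading_coef ?size_polyXn // coefXn eq_sym (negPf jS1).
have -> : j = #|S| by apply/eqP; rewrite eqn_leq jS Sj.
(* Subtracting [set_poly S] lowers the degree without changing the values on S; the coefficient of
   degree #|S| - 1 becomes the sum of S. *)
have : \sum_(x in S) ('X^#|S| - set_poly S).[x] / node_weight S x = 0.
  rewrite lagrange_leading_coef.
    rewrite coefB subleading_coef_set_poly // S0 coefXn oppr0 subr0.
    by rewrite (_ : _ == _ = false) //; lia.
  apply/leq_sizeP => i Si; rewrite coefB coefXn.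
  have [Si' | iS] := ltnP #|S| i.
    by rewrite nth_default ?size_set_poly // gtn_eqF // subrr.
  have -> : i = #|S| by apply/eqP; rewrite eqn_leq Si iS.
  by rewrite eqxx lead_coef_set_poly subrr.
move=> S_eq0; rewrite -[RHS]S_eq0; apply: eq_bigr => x xS.
rewrite hornerD hornerN hornerXn.
by rewrite (rootP _) ?root_set_poly ?subr0.
Qed.

End Interpolation.

(** * The self-dual code of polynomials of degree at most k without a term of degree k - 1 *)

Section GapCode.

Variables (F : finFieldType) (k n : nat) (S T : {set F}).
Variables (v : F -> F) (lambda : F).
Hypotheses (k_gt0 : (0 < k)%N) (n_def : n = k.*2) (S_card : #|S| = n).
Hypotheses (T_sub : T \subset S) (T_card : #|T| = k).
Hypotheses (S_sum : \sum_(x in S) x = 0) (T_sum : \sum_(x in T) x = 0).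
Hypothesis lambda_neq0 : lambda != 0.
Hypothesis v_sqr : {in S, forall x, v x ^+ 2 = lambda * node_weight S x}.

Let alpha (i : 'I_n) : F := (enum S)`_i.
Let scal (x : F) : F := v x / node_weight S x.

Let alphaS i : alpha i \in S.
Proof. by rewrite -mem_enum mem_nth // -cardE S_card. Qed.

Let alpha_inj : injective alpha.
Proof.
move=> i j /eqP; rewrite nth_uniq -?cardE ?S_card ?enum_uniq //.
by move/eqP/ord_inj.
Qed.

Let sum_alpha (g : F -> F) : \sum_(i < n) g (alpha i) = \sum_(x in S) g x.
Proof.
by rewrite -[RHS]big_enum (big_nth 0) -cardE S_card big_mkord.
Qed.

Let preim_card (A : {set F}) : A \subset S -> #|[set i | alpha i \in A]| = #|A|.
Proof.
move=> AS; rewrite -(card_imset _ alpha_inj); apply: eq_card => x.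
apply/imsetP/idP => [[i] | xA]; first by rewrite inE => ? ->.
have xS : x \in enum S by rewrite mem_enum (subsetP AS).
have ltx : (index x (enum S) < n)%N by rewrite -S_card cardE index_mem.
have ax : alpha (Ordinal ltx) = x by rewrite /alpha /= nth_index.
by exists (Ordinal ltx); rewrite ?inE ax.
Qed.

(* The exponents 0, 1, ..., k - 2, k. *)
Let expo (j : 'I_k) : nat := if j == k.-1 :> nat then k else j.

Let G : 'M[F]_(k, n) :=
  \matrix_(j, i) (scal (alpha i) * alpha i ^+ expo j).

Let gap_poly (x : 'rV[F]_k) : {poly F} := \sum_(j < k) x ord0 j *: 'X^(expo j).

Let size_gap_poly x : (size (gap_poly x) <= k.+1)%N.
Proof.
apply: leq_trans (size_sum _ _ _) _; apply/bigmax_leqP => j _.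
apply: leq_trans (size_scale_leq _ _) _; rewrite size_polyXn ltnS /expo.
by case: ifP => // _; apply: ltnW.
Qed.

Let expo_inj : injective expo.
Proof.
move=> i j; rewrite /expo; have := ltn_ord i; have := ltn_ord j.
by case: ifP => [/eqP|] h1; case: ifP => [/eqP|] h2 ? ? ?; apply: ord_inj; lia.
Qed.

Let coef_gap_poly x j : (gap_poly x)`_(expo j) = x ord0 j.
Proof.
rewrite coef_sum (bigD1 j) //= coefZ coefXn eqxx mulr1 big1 ?addr0 // => i ij.
by rewrite coefZ coefXn (inj_eq expo_inj) eq_sym (negPf ij) mulr0.
Qed.

Let mulG x i :
  (x *m G) ord0 i = scal (alpha i) * (gap_poly x).[alpha i].
Proof.
rewrite mxE horner_sum mulr_sumr; apply: eq_bigr => j _.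
by rewrite mxE hornerZ hornerXn mulrCA.
Qed.

Let scal_neq0 x : x \in S -> scal x != 0.
Proof.
move=> xS; rewrite mulf_neq0 ?invr_eq0 ?node_weight_neq0 //.
have: v x ^+ 2 != 0 by rewrite v_sqr // mulf_neq0 ?node_weight_neq0.
by rewrite expf_eq0.
Qed.

Let zeros (c : 'rV[F]_n) : {set 'I_n} := [set i | c ord0 i == 0].

(** The zero word has 2k > k zeros, so with [zeros_card] only x = 0 is encoded as 0. *)
Let zeros0 : (k < #|zeros 0%R|)%N.
Proof.
rewrite (_ : zeros 0 = setT) ?cardsT ?card_ord; first by lia.
by apply/setP => i; rewrite !inE mxE eqxx.
Qed.

Let zeros_mulG (x : 'rV[F]_k) : zeros (x *m G) =
  [set i | root (gap_poly x) (alpha i)].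
Proof.
by apply/setP => i; rewrite !inE mulG mulf_eq0 (negPf (scal_neq0 (alphaS i))).
Qed.

Let zeros_card (x : 'rV[F]_k) : x != 0 -> (#|zeros (x *m G)| <= k)%N.
Proof.
move=> x0; rewrite zeros_mulG -(card_imset _ alpha_inj) leqNgt; apply/negP.
move=> card_gt; case/negP: x0; apply/eqP/rowP => j.
rewrite mxE -coef_gap_poly.
rewrite (@set_roots_eq0 _ (alpha @: [set i | root (gap_poly x) (alpha i)])
          (gap_poly x)).
- by rewrite coef0.
- by move=> y /imsetP[i]; rewrite inE => ? ->.
- exact: leq_trans (size_gap_poly x) card_gt.
Qed.

Let rankG : \rank G = k.
Proof.
apply/eqP; rewrite -[_ == _]/(row_free G) -kermx_eq0; apply/eqP/row_matrixP => i.
rewrite row0; apply/eqP/negPn/negP => /zeros_card.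
by rewrite -row_mul mulmx_ker row0 leqNgt zeros0.
Qed.

Let GGt : G *m G^T = 0.
Proof.
apply/matrixP => j l; rewrite !mxE.
have -> : \sum_i G j i * G^T i l =
    \sum_i lambda * (alpha i ^+ (expo j + expo l) / node_weight S (alpha i)).
  apply: eq_bigr => i _; rewrite !mxE /scal exprD.
  (* Brings the two factors v together, so that [v_sqr] cancels one division by the weight. *)
  have -> : forall a b c d e : F, a / b * c * (a / b * d) = e * (c * d / b) <->
      a ^+ 2 * (c * d / b / b) = e * (c * d / b).
    by move=> a b c d e; rewrite (_ : a ^+ 2 * _ = a / b * c * (a / b * d)) //; ring.
  by rewrite v_sqr //; field; apply: node_weight_neq0.
rewrite -mulr_sumr.
rewrite (sum_alpha (fun x => x ^+ (expo j + expo l) / node_weight S x)).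
(* Two exponents from 0, ..., k - 2, k add up to 2k or to at most 2k - 2, never to n - 1. *)
rewrite sum_expr_node_weight ?mulr0 // S_card n_def /expo;
  have := ltn_ord j; have := ltn_ord l; case: ifP => h1; case: ifP => h2; lia.
Qed.

Let C : {vspace 'rV[F]_n} := limg (linfun (mulmxr G)).

Let memC c : reflect (exists x, c = x *m G) (c \in C).
Proof.
by apply: (iffP memv_imgP) => [[x _ ->]|[x ->]]; exists x; rewrite ?memvf ?lfunE.
Qed.

Let memC_sub c : (c \in C) = (c <= G)%MS.
Proof. by apply/memC/submxP. Qed.

Let dimC : \dim C = k.
Proof.
rewrite limg_dim_eq ?dimvf ?/dim /= ?mul1n //; apply/eqP; rewrite -subv0.
apply/subvP => x; rewrite memv_cap memv_ker lfunE /= memv0 => /andP[_ /eqP xG].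
apply/negPn/negP => /zeros_card.
by rewrite xG leqNgt zeros0.
Qed.

(** [GGt] puts the code inside its dual, and the rank k = n - k forces equality. *)
Let self_dualC : self_dual C.
Proof.
have GK : (G == kermx G^T)%MS.
  have GK : (G <= kermx G^T)%MS by apply/sub_kermxP.
  rewrite -(mxrank_leqif_eq GK) mxrank_ker mxrank_tr rankG n_def -addnn.
  by rewrite addnK.
apply/vspaceP => b; rewrite memC_sub (eqmxP GK) sub_kermx.
apply/eqP/dual_codeP => [bG a /memC[x ->] | bC].
  have := congr1 (fun M => (x *m M) ord0 ord0) (congr1 trmx bG).
  rewrite trmx_mul trmxK mulmxA trmx0 mulmx0 !mxE => h; rewrite -[RHS]h.
  by apply: eq_bigr => i _; rewrite !mxE.
apply/rowP => j; rewrite !mxE -[RHS](bC (row j G)).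
  by apply: eq_bigr => i _; rewrite !mxE mulrC.
by rewrite memC_sub row_sub.
Qed.

Let distE (x y : 'rV[F]_n) :
  hamming_dist x y = (n - #|zeros (x - y)%R|)%N.
Proof.
rewrite /hamming_dist cardsCs card_ord; congr (_ - #|pred_of_set _|)%N.
by apply/setP => i; rewrite !inE !mxE subr_eq0 negbK.
Qed.

Let min_distC : is_min_dist C k.
Proof.
split; last first.
  move=> x y xC yC xy; have := memvB xC yC => /memC[z zE].
  have z0 : z != 0.
    by apply: contraNneq xy => z0; rewrite -subr_eq0 zE z0 mul0mx.
  by have := zeros_card z0; rewrite distE zE; lia.
(* The message with polynomial [set_poly T]: its codeword vanishes exactly at the k positions of
   T. *)
pose x : 'rV[F]_k := \row_j (set_poly T)`_(expo j).
have gapx : gap_poly x = set_poly T.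
  apply/polyP => i; have [i_k | k_i] := ltnP k i.
    rewrite !nth_default // ?size_set_poly ?T_card //.
    exact: leq_trans (size_gap_poly x) _.
  (* At the missing exponent k - 1 both coefficients are zero, that of [set_poly T] because T sums
     to zero. *)
  have [/eqP ik | ik] := boolP (i == k.-1).
    have -> : (set_poly T)`_i = 0.
      by rewrite ik -T_card subleading_coef_set_poly ?T_sum ?oppr0 ?T_card.
    rewrite coef_sum big1 // => j _; rewrite coefZ coefXn ik /expo.
    by rewrite (_ : _ == _ = false) ?mulr0 //; case: ifP => h; have := ltn_ord j; lia.
  have [j <-] : exists j : 'I_k, expo j = i.
    have [iltk | ki] := ltnP i k.
      by exists (Ordinal iltk); rewrite /expo /= (negPf ik).
    have k1 : (k.-1 < k)%N by rewrite prednK.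
    exists (Ordinal k1); rewrite /expo /= eqxx.
    by apply/eqP; rewrite eqn_leq ki k_i.
  by rewrite coef_gap_poly mxE.
have dk : hamming_dist (x *m G) 0 = k.
  rewrite distE subr0 zeros_mulG gapx.
  have -> : [set i | root (set_poly T) (alpha i)] = [set i | alpha i \in T].
    by apply/setP => i; rewrite !inE root_set_poly.
  by rewrite preim_card // T_card n_def -addnn addnK.
exists (x *m G), 0; split=> //; first by apply/memC; exists x.
  exact: mem0v.
apply: contraTneq zeros0 => xG; rewrite -leqNgt.
by have := dk; rewrite xG distE subr0; lia.
Qed.

Lemma gap_code_NMDS_self_dual :
  exists C : {vspace 'rV[F]_n}, NMDS C /\ self_dual C.
Proof.
exists C; split; last exact: self_dualC.
have CA : AMDS C.
  by exists k, k; split; [split | rewrite n_def -addnn addnK].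
by split; rewrite // -self_dualC.
Qed.

End GapCode.

(** * Primitive roots, squares and unions of cosets in a finite field *)

Section FiniteField.

Variable F : finFieldType.
Implicit Types (S T D : {set F}) (x y z : F).

Let card_gt1 : (1 < #|F|)%N.
Proof. exact: finNzRing_gt1. Qed.

Lemma finField_prim_root : exists z : F, (#|F|.-1).-primitive_root z.
Proof.
have F_gt1 := card_gt1.
have /hasP[z _ zP] : has (#|F|.-1).-primitive_root (enum [set~ (0 : F)]).
  apply: has_prim_root; last by rewrite -cardE cardsC1.
  - by lia.
  - apply/allP => x; rewrite mem_enum !inE => x0.
    apply/unity_rootP/(mulfI x0).
    by rewrite -exprS prednK ?expf_card ?mulr1 // ltnW.
  - exact: enum_uniq.
by exists z.
Qed.

Lemma finField_prim_root_dvd m : (m %| #|F|.-1)%N ->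
  exists z : F, m.-primitive_root z.
Proof.
have [z zP] := finField_prim_root => m_dv.
by exists (z ^+ (#|F|.-1 %/ m)); apply: dvdn_prim_root.
Qed.

(** Write x = z^i with z a generator; the hypothesis forces i to be even. *)
Lemma euler_criterion x : odd #|F| -> x ^+ (#|F|.-1)./2 = 1 ->
  exists y, y ^+ 2 = x.
Proof.
have F_gt1 := card_gt1 => F_odd xh1.
have hE : (#|F|.-1 = (#|F|.-1)./2 * 2)%N by lia.
have [z zP] := finField_prim_root.
have x1 : x ^+ #|F|.-1 = 1 by rewrite {1}hE exprM xh1 expr1n.
have [i xE] := prim_rootP zP x1.
have : (#|F|.-1 %| i * (#|F|.-1)./2)%N by rewrite (prim_order_dvd zP) exprM -xE xh1.
rewrite {1}hE mulnC dvdn_pmul2r; last by lia.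
by move=> /dvdnP[j ij]; exists (z ^+ j); rewrite -exprM -ij.
Qed.

Lemma NMDS_self_dual_of_halves n k S T : odd #|F| ->
  (0 < k)%N -> n = k.*2 -> #|S| = n -> T \subset S -> #|T| = k ->
  \sum_(x in S) x = 0 -> \sum_(x in T) x = 0 ->
  (exists c, {in S, forall x, node_weight S x ^+ (#|F|.-1)./2 = c}) ->
  exists C : {vspace 'rV[F]_n}, NMDS C /\ self_dual C.
Proof.
move=> F_odd k_gt0 nE Sn TS Tk S0 T0 [c wc].
have /card_gt0P[x0 x0S] : (0 < #|S|)%N by lia.
(* With one of the weights as [lambda], each product [lambda * node_weight S x] has quadratic
   character c^2 = 1, so it is a square. *)
pose lambda := node_weight S x0.
(* The existential stands outside the implication, with 0 as value off S, so that v can be chosen on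
   all of F. *)
have sq x : exists v, x \in S -> v ^+ 2 = lambda * node_weight S x.
  case: (boolP (x \in S)) => [xS|_]; last by exists 0.
  have [|v vE] := @euler_criterion (lambda * node_weight S x) F_odd.
    rewrite exprMn !wc // -(wc _ x0S) -exprMn -expr2 -exprM.
    have -> : (2 * (#|F|.-1)./2 = #|F|.-1)%N by have := card_gt1; lia.
    apply: (mulfI (node_weight_neq0 S x0)).
    by rewrite -exprS prednK ?expf_card ?mulr1 // ltnW ?card_gt1.
  by exists v.
have [v vP] := fin_all_exists sq.
apply: (@gap_code_NMDS_self_dual F k n S T v lambda) => //.
exact: node_weight_neq0.
Qed.

(* The union of the cosets z^i mu_m for i < j, where mu_m is the group of m-th
   roots of unity. *)
Definition power_cosets (m : nat) (z : F) (j : nat) : {set F} :=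
  [set x | [exists i : 'I_j, x ^+ m == (z ^+ m) ^+ i]].

Lemma power_cosetsP m z j x :
  reflect (exists i : 'I_j, x ^+ m = (z ^+ m) ^+ i) (x \in power_cosets m z j).
Proof. by rewrite inE; apply: 'exists_eqP. Qed.

(** The elements are z^i theta^l with theta of order m; the m-th power recovers i because z^m has
    order c >= j. *)
Lemma card_power_cosets m z c j : (m %| #|F|.-1)%N ->
  c.-primitive_root (z ^+ m) -> (j <= c)%N ->
  #|power_cosets m z j| = (j * m)%N.
Proof.
move=> m_dv zP jc; have [theta thetaP] := finField_prim_root_dvd m_dv.
have m_gt0 := prim_order_gt0 thetaP.
have z0 : z != 0.
  apply/eqP => z0; have := prim_expr_order zP; rewrite z0 expr0n gtn_eqF //.
  by rewrite expr0n gtn_eqF ?(prim_order_gt0 zP) // => /eqP; rewrite eq_sym oner_eq0.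
pose h (p : 'I_j * 'I_m) := z ^+ p.1 * theta ^+ p.2.
have hm p : h p ^+ m = (z ^+ m) ^+ p.1.
  by rewrite exprMn exprAC [theta ^+ _ ^+ _]exprAC (prim_expr_order thetaP)
               expr1n mulr1.
have h_inj : injective h.
  move=> p p' hE; have : (z ^+ m) ^+ p.1 == (z ^+ m) ^+ p'.1.
    by rewrite -!hm hE.
  rewrite (eq_prim_root_expr zP) !modn_small; last exact: leq_trans jc.
    move/eqP/ord_inj => p1; move: hE; rewrite /h p1.
    move/(mulfI (expf_neq0 _ z0))/eqP.
    rewrite (eq_prim_root_expr thetaP) !modn_small // => /eqP/ord_inj.
    by case: p p' p1 => [? ?] [? ?] /= -> ->.
  exact: leq_trans jc.
have -> : power_cosets m z j = h @: setT.
  apply/setP => x; apply/power_cosetsP/imsetP => [[i xE] | [p _ ->]].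
    have : (x / z ^+ i) ^+ m = 1.
      by rewrite expr_div_n xE exprAC divff ?expf_neq0.
    case/(prim_rootP thetaP) => l lE; exists (i, l) => //.
    by rewrite /h -lE mulrC divfK ?expf_neq0.
  by exists p.1.
by rewrite card_imset // cardsT card_prod !card_ord.
Qed.

(** Multiplication by an m-th root of unity theta != 1 permutes the set, so its sum s satisfies s =
    theta s. *)
Lemma sum_power_cosets m z j : (m %| #|F|.-1)%N -> (1 < m)%N ->
  \sum_(x in power_cosets m z j) x = 0.
Proof.
move=> m_dv m_gt1; have [theta thetaP] := finField_prim_root_dvd m_dv.
have theta0 : theta != 0 by rewrite (prim_root_eq0 thetaP); lia.
have theta1 : theta != 1.
  have := eq_prim_root_expr thetaP 1 0; rewrite expr1 expr0 => ->.
  by rewrite modn_small // mod0n.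
set s := \sum_(x in _) x.
have sE : s = theta * s.
  rewrite {1}/s (reindex_inj (mulfI theta0)) /= mulr_sumr.
  by apply: eq_bigl => x; rewrite !inE exprMn (prim_expr_order thetaP) mul1r.
apply/eqP; rewrite -(mulrI_eq0 _ (mulfI _ : GRing.lreg (theta - 1))); last first.
  by rewrite subr_eq0.
by rewrite mulrBl mul1r -sE subrr.
Qed.

(** The set polynomial is the product of the X^m - z^(ml); in its derivative at x only the term
    differentiating the factor l = i survives. *)
Lemma node_weight_power_cosets m z c j x (i : 'I_j) : (m %| #|F|.-1)%N ->
  c.-primitive_root (z ^+ m) -> (j <= c)%N -> x ^+ m = (z ^+ m) ^+ i ->
  node_weight (power_cosets m z j) x =
  m%:R * x ^+ m.-1 * \prod_(l < j | l != i) ((z ^+ m) ^+ i - (z ^+ m) ^+ l).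
Proof.
move=> m_dv zP jc xE; set S := power_cosets m z j.
have m_gt0 : (0 < m)%N by apply: dvdn_gt0 m_dv; have := card_gt1; lia.
have xS : x \in S by apply/power_cosetsP; exists i.
have SE : \prod_(l < j) ('X^m - ((z ^+ m) ^+ l)%:P) = set_poly S.
  apply: monic_set_polyE; first by apply: monic_prod => l _; apply: monicXnsubC.
    rewrite size_prod => [|l _]; last exact/monic_neq0/monicXnsubC.
    under eq_bigr => l _ do rewrite size_XnsubC //.
    rewrite sum_nat_const card_ord (card_power_cosets m_dv zP jc).
    by rewrite mulnS -addnS addnC addnK.
  move=> y /power_cosetsP[l yE]; rewrite rootE horner_prod (bigD1 l) //=.
  by rewrite !hornerE yE subrr mul0r.
rewrite -deriv_set_poly // -SE (bigD1 i) //= derivM hornerD !hornerM !hornerE.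
rewrite xE subrr mul0r addr0 derivB derivC derivXn subr0 hornerMn hornerXn mulr_natl.
by rewrite horner_prod; congr (_ * _); apply: eq_bigr => l _; rewrite !hornerE xE.
Qed.

End FiniteField.

(** * Sets closed under negation *)

Section SymmetricSets.

Variable F : finFieldType.
Implicit Types D P Z : {set F}.

Definition opp_set D : {set F} := [set x | - x \in D].

Lemma card_opp_set D : #|opp_set D| = #|D|.
Proof.
rewrite -(card_imset _ (@oppr_inj F)); apply: eq_card => x.
apply/imsetP/idP => [[y] | xD]; first by rewrite inE => ? ->.
by exists (- x); rewrite ?inE opprK.
Qed.

Lemma sum_opp_set D : \sum_(x in opp_set D) x = - \sum_(x in D) x.
Proof.
rewrite (reindex_inj (@oppr_inj F)) /= -sumrN.
by apply: eq_bigl => x; rewrite inE opprK.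
Qed.

Hypothesis two_neq0 : 2%:R != 0 :> F.

Lemma opp_neq (x : F) : x != 0 -> - x != x.
Proof.
by move=> x0; rewrite eq_sym -subr_eq0 opprK -mulr2n -mulr_natl mulf_neq0.
Qed.

Lemma sum_symmetric D : opp_set D = D -> \sum_(x in D) x = 0.
Proof.
move=> DE; have /eqP := sum_opp_set D; rewrite DE -subr_eq0 opprK -mulr2n.
by rewrite -mulr_natl mulf_eq0 (negPf two_neq0) => /eqP.
Qed.

Lemma opp_setD D P : opp_set (D :\: P) = opp_set D :\: opp_set P.
Proof. by apply/setP => x; rewrite !inE. Qed.

(** Pairs {x, -x} are added one at a time; x and -x differ since x and 2 are nonzero. *)
Lemma symmetric_subset D j : 0 \notin D -> opp_set D = D -> (j.*2 <= #|D|)%N ->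
  exists P, [/\ P \subset D, opp_set P = P & #|P| = j.*2].
Proof.
move=> D0 DE; elim: j => [|j IHj] jD.
  exists set0; rewrite sub0set cards0; split=> //.
  by apply/setP => x; rewrite !inE.
have [|P [PD PE Pj]] := IHj; first by lia.
have /card_gt0P[x] : (0 < #|D :\: P|)%N.
  by rewrite cardsD (setIidPr PD) Pj; lia.
rewrite inE => /andP[xP xD].
have x0 : x != 0 by apply: contraNneq D0 => <-.
have symD y : (- y \in D) = (y \in D) by rewrite -[in RHS]DE inE.
have symP y : (- y \in P) = (y \in P) by rewrite -[in RHS]PE inE.
exists (x |: (- x |: P)); split.
- by apply/subsetP => y; rewrite !inE => /or3P[/eqP->|/eqP->|/(subsetP PD)];
    rewrite ?symD.
- apply/setP => y; rewrite !inE symP eqr_oppLR eqr_opp.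
  by rewrite orbCA.
- by rewrite !cardsU1 !inE Pj eq_sym (negPf (opp_neq x0)) symP (negPf xP); lia.
Qed.

End SymmetricSets.

(** * The field of order r^2 *)

Section SquareOrder.

Variables (r : nat) (F : finFieldType).
Hypotheses (r_pp : prime_power r) (r_odd : odd r) (F_card : #|F| = (r ^ 2)%N).

Let r_gt1 : (1 < r)%N.
Proof.
case: r_pp => p [m [p_pr m_gt0 ->]]; rewrite -(exp1n m) ltn_exp2r //.
exact: prime_gt1.
Qed.

Let card1 : (#|F|.-1 = r.+1 * r.-1)%N.
Proof. by rewrite F_card; nia. Qed.

Let half1 : ((#|F|.-1)./2 = r.+1 * r.-1./2)%N.
Proof.
have rE : (r.-1 = r.-1./2 * 2)%N by lia.
by rewrite card1 {1}rE mulnA muln2 doubleK.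
Qed.

Let rS_half : (r.+1 = r.+1./2 * 2)%N.
Proof. by rewrite muln2 even_halfK //= negbK. Qed.

Let half2 : ((#|F|.-1)./2 = r.-1 * r.+1./2)%N.
Proof.
by rewrite card1 {1}rS_half mulnC mulnA muln2 doubleK.
Qed.

Let F_odd : odd #|F|.
Proof. by rewrite F_card oddX r_odd orbT. Qed.

(** r is a power of the characteristic. *)
Lemma frobeniusB (x y : F) : (x - y) ^+ r = x ^+ r - y ^+ r.
Proof.
case: r_pp => p [m [p_pr m_gt0 rE]].
have Fr : [pchar F].-nat r.
  rewrite rE pnatX pnatE // (@card_finPcharP F p (m * 2)) //.
  by rewrite F_card rE expnM.
by rewrite exprDn_pchar // exprNn_pchar.
Qed.

Let two_neq0 : 2%:R != 0 :> F.
Proof.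
have [z zP] := finField_prim_root F; apply: (prim_root_dvd_eq0 zP).
by rewrite dvdn2; have := F_odd; have := card1; lia.
Qed.

(** * Quadratic character of the node weights on a union of cosets *)

Section Cosets.

Variables (e f t n : nat) (u : F).
Hypotheses (e_even : ~~ odd e) (q_ef : #|F|.-1 = (e * f)%N).
Hypotheses (t_gt0 : (0 < t)%N) (t_le : (t <= r.+1 %/ gcdn r.+1 f)%N).
Hypotheses (tf_even : ~~ odd (t * f)) (uP : r.+1.-primitive_root u).

Let f_dvd : (f %| #|F|.-1)%N.
Proof. by rewrite q_ef dvdn_mull. Qed.

(** R is the order of u^f, so t <= R keeps the t cosets distinct. *)
Let ufP : (r.+1 %/ gcdn r.+1 f).-primitive_root (u ^+ f).
Proof. by rewrite gcdnC; apply: exp_prim_root. Qed.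

(** The common value of x^f on the i-th coset. *)
Let gam (i : nat) : F := (u ^+ f) ^+ i.

Let gam_norm i : gam i ^+ r.+1 = 1.
Proof.
by rewrite /gam exprAC [u ^+ f ^+ _]exprAC (prim_expr_order uP) !expr1n.
Qed.

Let gam_neq0 i : gam i != 0.
Proof.
apply/eqP => gi0; have /eqP := gam_norm i.
by rewrite gi0 expr0n eq_sym oner_eq0.
Qed.

Let frob_diff i l : (gam i - gam l) ^+ r * gam i * gam l = - (gam i - gam l).
Proof.
have gr j : gam j * gam j ^+ r = 1 by rewrite -exprS gam_norm.
rewrite frobeniusB.
rewrite (_ : _ * _ * _ = (gam i * gam i ^+ r) * gam l - (gam l * gam l ^+ r) * gam i).
  by rewrite !gr; ring.
by ring.
Qed.

(* Since the norm of u is 1, conjugation sends gam i - gam l to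
   - (gam i - gam l) / (gam i * gam l); this makes the (r-1)-st power of the
   product of differences depend on i only through a power of gam i. *)
Lemma node_weight_cosets_char :
  exists c, {in power_cosets f u t, forall x,
    node_weight (power_cosets f u t) x ^+ (#|F|.-1)./2 = c}.
Proof.
pose W := \prod_(l < t) gam l.
exists (f%:R ^+ (#|F|.-1)./2 * ((-1) ^+ t.-1 / W) ^+ r.+1./2).
move=> x /power_cosetsP[i xE].
have q_neq0 := node_weight_neq0 (power_cosets f u t) x.
rewrite (node_weight_power_cosets f_dvd ufP t_le xE) in q_neq0 *.
set Q := \prod_(l < t | l != i) _ in q_neq0 *.
have Q0 : Q != 0 by move: q_neq0; rewrite mulf_eq0 negb_or => /andP[].
(* As e is even, f divides (q - 1)/2, so this is a power of x^f and hence of u, with exponent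
   divisible by r + 1. *)
have xh : x ^+ (#|F|.-1)./2 = 1.
  have eE : (e = e./2 * 2)%N by rewrite muln2 even_halfK.
  have hE : ((#|F|.-1)./2 = f * e./2)%N.
    by rewrite q_ef {1}eE mulnAC muln2 doubleK mulnC.
  rewrite hE exprM xE -!exprM mulnAC -hE half1 -mulnA.
  by rewrite exprM (prim_expr_order uP) expr1n.
rewrite exprMn [X in X * _]exprMn exprAC xh expr1n mulr1; congr (_ * _).
have W0 : W != 0 by apply/prodf_neq0 => l _.
(* The product of [frob_diff] over l != i, divided by Q. *)
have QE : Q ^+ r.-1 * gam i ^+ t = (-1) ^+ t.-1 / W * gam i ^+ 2.
  apply: (mulIf (mulf_neq0 Q0 W0)).
  have : \prod_(l < t | l != i) ((gam i - gam l) ^+ r * gam i * gam l) =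
      (-1) ^+ t.-1 * Q.
    under eq_bigr => l _ do rewrite frob_diff.
    by rewrite prodrN cardC1 card_ord.
  rewrite !big_split /= prodrXl prodr_const cardC1 card_ord -/Q => QE.
  have -> : W = gam i * \prod_(l < t | l != i) gam l by rewrite /W (bigD1 i).
  have tE : gam i ^+ t = gam i * gam i ^+ t.-1 by rewrite -exprS prednK.
  rewrite tE.
  have rE : Q ^+ r = Q ^+ r.-1 * Q by rewrite -exprSr prednK // ltnW.
  rewrite rE in QE.
  set P := \prod_(l < t | l != i) gam l in QE *.
  have P0 : P != 0 by apply/prodf_neq0 => l _.
  transitivity (gam i ^+ 2 * (Q ^+ r.-1 * Q * gam i ^+ t.-1 * P)); first by ring.
  by rewrite QE; field; rewrite P0 gam_neq0.
(* As tf is even, tf(r + 1)/2 is a multiple of r + 1, the order of u. *)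
have gt1 : (gam i ^+ t) ^+ r.+1./2 = 1.
  have -> : (gam i ^+ t) ^+ r.+1./2 = (u ^+ (t * f * r.+1./2)) ^+ i.
    by rewrite /gam -!exprM; congr (u ^+ _); ring.
  have -> : (t * f * r.+1./2 = r.+1 * (t * f)./2)%N.
    have tfE : (t * f = (t * f)./2 * 2)%N by rewrite muln2 even_halfK.
    by rewrite {1}tfE [in RHS]rS_half; ring.
  by rewrite exprM (prim_expr_order uP) !expr1n.
have gr : (gam i ^+ 2) ^+ r.+1./2 = 1.
  by rewrite -exprM mulnC -rS_half gam_norm.
have := congr1 (fun y => y ^+ r.+1./2) QE.
by rewrite exprMn [RHS]exprMn gt1 gr !mulr1 -exprM -half2.
Qed.

End Cosets.

(** * Codes on unions of cosets, for f > 2 *)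

Lemma cosets_NMDS_self_dual e f t n : ~~ odd e -> (#|F|.-1 = e * f)%N ->
  (2 < f)%N -> (0 < t)%N -> (t <= r.+1 %/ gcdn r.+1 f)%N -> n = (t * f)%N ->
  ~~ odd n -> exists C : {vspace 'rV[F]_n}, NMDS C /\ self_dual C.
Proof.
move=> e_even q_ef f_gt2 t_gt0 t_le nE n_even.
have [u uP] : exists u : F, r.+1.-primitive_root u.
  by apply: finField_prim_root_dvd; rewrite card1 dvdn_mulr.
have f_dvd : (f %| #|F|.-1)%N by rewrite q_ef dvdn_mull.
have ordP m : (r.+1 %/ gcdn r.+1 m).-primitive_root (u ^+ m).
  by rewrite gcdnC; apply: exp_prim_root.
pose S := power_cosets f u t.
have n2 : n = n./2.*2 by rewrite even_halfK.
have Sn : #|S| = n by rewrite (card_power_cosets f_dvd (ordP f) t_le).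
have S0 : \sum_(x in S) x = 0 by rewrite sum_power_cosets // ltnW.
have Sc : exists c, {in S, forall x, node_weight S x ^+ (#|F|.-1)./2 = c}.
  by apply: (node_weight_cosets_char e_even q_ef); rewrite -?nE.
have n_gt0 : (0 < n./2)%N.
  have : (0 < n)%N by rewrite nE muln_gt0 t_gt0 ltnW // ltnW.
  by rewrite {1}n2 double_gt0.
have [f_odd | f_even] := boolP (odd f).
  (* For odd f, t is even and T consists of the first t/2 cosets. *)
  have tE : t = t./2.*2.
    by rewrite even_halfK //; move: n_even; rewrite nE oddM f_odd andbT.
  have t2_le : (t./2 <= t)%N by rewrite -divn2 leq_div.
  apply: (@NMDS_self_dual_of_halves F n n./2 S (power_cosets f u t./2)) => //.
  - apply/subsetP => x /power_cosetsP[i xE]; apply/power_cosetsP.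
    by exists (widen_ord t2_le i).
  - rewrite (card_power_cosets f_dvd (ordP f)) ?(leq_trans t2_le) //.
    by apply: double_inj; rewrite -n2 nE doubleMl -tE.
  - by rewrite sum_power_cosets // ltnW.
(* For even f, T takes from each coset the subcoset of the (f/2)-th roots of unity; f > 2 gives f/2
   > 1, which the zero sum needs. *)
have fE : f = f./2.*2 by rewrite even_halfK.
have f2_dvd : (f./2 %| #|F|.-1)%N.
  by apply: dvdn_trans f_dvd; rewrite {2}fE -muln2 dvdn_mulr.
apply: (@NMDS_self_dual_of_halves F n n./2 S (power_cosets f./2 u t)) => //.
- apply/subsetP => x /power_cosetsP[i xE]; apply/power_cosetsP; exists i.
  by rewrite fE -muln2 !exprM xE exprAC.
- rewrite (card_power_cosets f2_dvd (ordP _)).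
    by apply: double_inj; rewrite -n2 nE doubleMr -fE.
  (* The order of u^(f/2) is at least that of u^f. *)
  apply: leq_trans t_le _; apply: leq_div2l.
    by rewrite gcdn_gt0.
  apply: dvdn_leq; first by rewrite gcdn_gt0.
  by rewrite dvdn_gcd dvdn_gcdl (dvdn_trans (dvdn_gcdr _ _)) //
             {2}fE -muln2 dvdn_mulr.
- by rewrite sum_power_cosets //; move: f_gt2 f_even; clear; lia.
Qed.

(** * Node sets inside the subfield of order r *)

(* The nonzero elements of the subfield of order r. *)
Let B : {set F} := power_cosets r.-1 1 1.

Let memB x : (x \in B) = (x != 0) && (x ^+ r == x).
Proof.
have rE : r = r.-1.+1 by rewrite prednK // ltnW.
apply/power_cosetsP/andP => [[i] | [x0 /eqP xr]].
  rewrite !expr1n => x1; split; last by rewrite rE exprS x1 mulr1.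
  apply: contra_eq_neq x1 => ->; rewrite expr0n eq_sym.
  by rewrite (_ : r.-1 == 0%N = false) ?oner_eq0 //; lia.
by exists ord0; apply: (mulfI x0); rewrite !expr1n mulr1 -exprS -rE.
Qed.

Let cardB : #|B| = r.-1.
Proof.
have r_dvd : (r.-1 %| #|F|.-1)%N by rewrite card1 dvdn_mull.
have z1P : 1.-primitive_root ((1 : F) ^+ r.-1).
  have [m mP] := prim_order_exists (ltn0Sn 0) (expr1n F 1).
  by rewrite dvdn1 expr1n => /eqP <-.
by rewrite (card_power_cosets r_dvd z1P) // mul1n.
Qed.

Let B_N x : (- x \in B) = (x \in B).
Proof.
by rewrite !memB oppr_eq0 exprNn -signr_odd r_odd mulN1r eqr_opp.
Qed.

(** The weights are nonzero and fixed by x -> x^r, so their (r-1)-st powers are 1, and r - 1 divides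
    (q - 1)/2. *)
Let node_weight_subfield (S : {set F}) : S \subset B ->
  {in S, forall x, node_weight S x ^+ (#|F|.-1)./2 = 1}.
Proof.
move=> SB x xS; have w0 := node_weight_neq0 S x.
have wr : node_weight S x ^+ r = node_weight S x.
  rewrite -prodrXl; apply: eq_bigr => y /setD1P[_ yS].
  have := subsetP SB _ xS; have := subsetP SB _ yS; rewrite !memB.
  by move=> /andP[_ /eqP yr] /andP[_ /eqP xr]; rewrite frobeniusB xr yr.
rewrite half2 exprM (_ : _ ^+ r.-1 = 1) ?expr1n //; apply: (mulfI w0).
by rewrite -exprS prednK ?wr ?mulr1 // ltnW.
Qed.

Let zero_sum_triple : (6 <= r.-1)%N -> exists Z : {set F},
  [/\ Z \subset B, [disjoint Z & opp_set Z], \sum_(x in Z) x = 0 & #|Z| = 3].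
Proof.
move=> r_ge7; have B1 : 1 \in B by rewrite memB oner_eq0 expr1n eqxx.
(* The values of b that spoil the triple 1, b, c = -1 - b: in this order they give b = 1, c = 0, c =
   1 and c = b. *)
pose E : {set F} := [set 1; -1; - 2%:R; - 2%:R^-1].
have /subsetPn[b bB] : ~~ (B \subset E).
  apply/negP => /subset_leq_card; rewrite cardB.
  by rewrite !cardsU !cards1; lia.
rewrite !inE !negb_or -!andbA => /and4P[b1 bN1 bN2 bNh].
have b0 : b != 0 by move: bB; rewrite memB => /andP[].
pose c : F := - 1 - b.
have bc0 : 1 + b != 0 by rewrite addrC addr_eq0.
have bcN : c = - (1 + b) by rewrite /c; ring.
have cB : c \in B.
  rewrite bcN B_N memB bc0 /=; move: bB; rewrite -B_N memB => /andP[_ /eqP br].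
  by rewrite -{1}[b]opprK frobeniusB expr1n br opprK.
have c1 : 1 != c.
  rewrite -subr_eq0 (_ : 1 - c = b - - 2%:R) ?subr_eq0 //; rewrite /c; ring.
have cb : b != c.
  apply: contraNneq bNh => bc; apply/eqP/(mulfI two_neq0).
  rewrite mulrN divff // mulr_natl mulr2n {2}bc /c; ring.
have c0 : c != 0 by move: cB; rewrite memB => /andP[].
exists (1 |: (b |: [set c])); split.
- by apply/subsetP => x; rewrite !in_setU1 in_set1 => /or3P[] /eqP->.
- rewrite -setI_eq0; apply/eqP/setP => x.
  rewrite [RHS]inE in_setI [X in _ && X]inE !in_setU1 !in_set1.
  have N1 (y : F) : y != 0 -> (- y == y) = false.
    by move=> y0; apply/negbTE; exact: opp_neq.
  (* Two distinct members add up to minus the third, which is nonzero, so no member is the opposite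
     of another. *)
  apply/negP => /andP[/or3P[] /eqP-> /or3P[]];
    rewrite ?N1 ?oner_eq0 //; rewrite eq_sym -subr_eq0 opprK.
  - by rewrite addrC (negPf bc0).
  - by rewrite (_ : c + 1 = - b) ?oppr_eq0 ?(negPf b0) // /c; ring.
  - by rewrite (negPf bc0).
  - by rewrite (_ : c + b = - 1) ?oppr_eq0 ?oner_eq0 // /c; ring.
  - by rewrite (_ : 1 + c = - b) ?oppr_eq0 ?(negPf b0) // /c; ring.
  - by rewrite (_ : b + c = - 1) ?oppr_eq0 ?oner_eq0 // /c; ring.
- rewrite !big_setU1 ?inE ?negb_or ?big_set1 //= ?c1 ?cb ?andbT;
    last by rewrite eq_sym.
  by rewrite /c; ring.
- by rewrite !cardsU1 !inE cards1 (negPf c1) (negPf cb) eq_sym (negPf b1).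
Qed.

Lemma subfield_NMDS_self_dual k : (1 < k)%N -> (k.*2 <= r.-1)%N ->
  exists C : {vspace 'rV[F]_k.*2}, NMDS C /\ self_dual C.
Proof.
move=> k_gt1 k_le.
(* Z is empty for even k and a triple for odd k >= 3; then k - #|Z| is even and can be filled with
   pairs {x, -x}. *)
have [Z [ZB Zd Z0 Zk Zodd]] : exists Z : {set F},
    [/\ Z \subset B, [disjoint Z & opp_set Z], \sum_(x in Z) x = 0,
        (#|Z| <= k)%N & odd #|Z| = odd k].
  have [k_odd | k_even] := boolP (odd k); last first.
    exists set0; rewrite sub0set big_set0 cards0 -setI_eq0 set0I.
    by split=> //; apply/esym/negPf.
  have [|Z [ZB Zd Z0 Zc]] := zero_sum_triple; first by lia.
  by exists Z; rewrite Zc; split=> //; lia.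
have symB : opp_set B = B by apply/setP => x; rewrite inE B_N.
have B0 : 0 \notin B by rewrite memB eqxx.
pose D := B :\: (Z :|: opp_set Z).
have symD : opp_set D = D.
  rewrite opp_setD symB; congr (_ :\: _).
  by apply/setP => x; rewrite !inE opprK orbC.
have D0 : 0 \notin D by rewrite inE (negPf B0) andbF.
have ZNB : opp_set Z \subset B.
  by apply/subsetP => x; rewrite inE => /(subsetP ZB); rewrite B_N.
have cardZZ : #|Z :|: opp_set Z| = (#|Z|).*2.
  by rewrite cardsU (disjoint_setI0 Zd) cards0 subn0 card_opp_set addnn.
have cardD : #|D| = (r.-1 - (#|Z|).*2)%N.
  by rewrite cardsD (setIidPr _) ?cardB ?cardZZ // subUset ZB.
pose j := (k - #|Z|)./2.
have jE : (k = #|Z| + j.*2)%N.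
  by rewrite /j even_halfK ?subnKC // oddB // Zodd addbb.
have jD : (j.*2.*2 <= #|D|)%N.
  by rewrite cardD; move: k_le jE; clearbody j; clear; lia.
have [|P [PD symP cardP]] := @symmetric_subset _ two_neq0 D j D0 symD.
  by apply: leq_trans jD; rewrite -[X in (_ <= X)%N]addnn leq_addr.
have symDP : opp_set (D :\: P) = D :\: P by rewrite opp_setD symD symP.
(* The other half needs j more pairs outside P; #|D| >= 4j leaves room for them. *)
have [||P' [PD' symP' cardP']] :=
  @symmetric_subset _ two_neq0 (D :\: P) j _ symDP.
- by rewrite inE (negPf D0) andbF.
- rewrite cardsD (setIidPr PD) cardP.
  by rewrite leq_subRL ?addnn // -cardP subset_leq_card.
pose T := Z :|: P; pose T' := opp_set Z :|: P'.
have dZP (A : {set F}) : A \subset D ->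
    [disjoint Z & A] /\ [disjoint opp_set Z & A].
  move=> AD; split; rewrite -setI_eq0 -subset0; apply/subsetP => x;
  by rewrite inE => /andP[xZ /(subsetP AD)]; rewrite 2!inE xZ ?orbT.
have PD'' : P' \subset D := subset_trans PD' (subsetDl _ _).
have [dP dNP] := dZP _ PD; have [dP' dNP'] := dZP _ PD''.
have dPP' : [disjoint P & P'].
  rewrite -setI_eq0 -subset0; apply/subsetP => x.
  by rewrite inE => /andP[xP /(subsetP PD')]; rewrite inE xP.
have cardU (A A' : {set F}) : [disjoint A & A'] ->
    #|A :|: A'| = (#|A| + #|A'|)%N.
  by move=> d; rewrite cardsU (disjoint_setI0 d) cards0 subn0.
have sumU (A A' : {set F}) : [disjoint A & A'] ->
    \sum_(x in A :|: A') x = \sum_(x in A) x + \sum_(x in A') x.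
  by move=> d; rewrite -bigU //=; apply: eq_bigl => x; rewrite inE.
have dTT' : [disjoint T & T'].
  rewrite -setI_eq0 setIUl !setIUr [P :&: opp_set Z]setIC.
  by rewrite !disjoint_setI0 // !setU0.
have TS : T \subset T :|: T' by apply: subsetUl.
apply: (@NMDS_self_dual_of_halves F _ k (T :|: T') T F_odd) => //.
- exact: ltnW.
- by rewrite cardU // !cardU // cardP cardP' card_opp_set -jE addnn.
- by rewrite cardU // cardP -jE.
- rewrite sumU // !sumU // sum_opp_set Z0 !(sum_symmetric two_neq0) //.
  by rewrite oppr0 !addr0.
- by rewrite sumU // Z0 (sum_symmetric two_neq0) ?addr0.
exists 1; apply: node_weight_subfield.
rewrite !subUset ZB ZNB (subset_trans PD (subsetDl _ _)).
by rewrite (subset_trans PD'' (subsetDl _ _)).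
Qed.

End SquareOrder.

(* Case distinction on f and on the length *)
Local Close Scope ring_scope.

(** Length 2 is excluded: such a code would have minimum distance 1, but a word of weight 1 is not
    orthogonal to itself. *)
Theorem theorem3p4 (r q e f t : nat) (F : finFieldType)
    (r_pp : prime_power r) (r_odd : odd r) (q_def : q = r ^ 2)
    (e_gt0 : 0 < e) (f_gt0 : 0 < f) (q_ef : q - 1 = e * f)
    (F_card : #|F| = q)
    (t_ge1 : 1 <= t) (t_leR : t <= r.+1 %/ gcdn r.+1 f)
    (tf_even : ~~ odd (t * f)) (e_even : ~~ odd e)
    (tf_neq2 : t * f <> 2) :
  exists C : {vspace 'rV[F]_(t * f)}, NMDS C /\ self_dual C.
Proof.
have F_r2 : #|F| = r ^ 2 by rewrite F_card.
have F1 : #|F|.-1 = e * f by rewrite F_card -subn1.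
have [f_gt2 | f_le2] := ltnP 2 f.
  exact: (@cosets_NMDS_self_dual r F r_pp r_odd F_r2 e f t (t * f) e_even F1
            f_gt2 t_ge1 t_leR erefl tf_even).
have tf_le : t * f <= r.+1.
  apply: leq_trans (leq_mul t_leR (leqnn f)) _.
  have [-> | ->] : f = 1 \/ f = 2 by lia.
    by rewrite gcdn1 divn1 muln1.
  by rewrite (gcdn_idPr _) ?divnK // dvdn2 /= r_odd.
set n := t * f in tf_even tf_neq2 tf_le *.
have n_gt0 : 0 < n by rewrite muln_gt0 t_ge1.
have [nE | n_neq] := eqVneq n r.+1.
  apply: (@cosets_NMDS_self_dual r F r_pp r_odd F_r2 r.-1 r.+1 1) => //.
  - by lia.
  - by rewrite F_r2 -subn1 (subn_sqr r 1) subn1 addn1.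
  - by lia.
  - by rewrite gcdnn divnn.
  - by rewrite mul1n.
(* Both n and r + 1 are even, so n < r + 1 gives n <= r - 1, and n != 2 gives n/2 > 1. *)
have nE : n = n./2.*2 by rewrite even_halfK.
by rewrite nE; apply: (subfield_NMDS_self_dual r_pp r_odd F_r2); lia.
Qed.
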